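(* Let $T\ge 2$ be an integer and let $\mu>0$, $\sigma>0$, $-\frac{1}{T-1}<\rho<1$ satisfy $\mu^2+\rho\sigma^2>0$. Let $$\mathrm{R}(\gamma)=\sup_{\mathbb P\in\mathcal P}\mathbb P\Big(\prod_{t=1}^T\tilde\xi_t\ge\gamma\Big),$$ with the ambiguity set $\mathcal P$ defined in the context. If $\rho\ge 0$, then $\mathrm{R}(\gamma)=1$ for all $\gamma\le\mu^T$.
   Context: Let $\boldsymbol\mu=\mu\boldsymbol 1\in\mathbb R^T$ and $\boldsymbol\Sigma=(1-\rho)\sigma^2\mathbb I+\rho\sigma^2\boldsymbol 1\boldsymbol 1^\intercal$, where $\mathbb I$ is the $T\times T$ identity matrix and $\boldsymbol 1$ the all-ones vector. $\mathcal P$ is the set of all Borel probability distributions $\mathbb P$ of a random vector $\tilde{\boldsymbol\xi}=(\tilde\xi_1,\dots,\tilde\xi_T)^\intercal$ supported on $\mathbb R^T_+$ with $\mathbb E_{\mathbb P}(\tilde{\boldsymbol\xi})=\boldsymbol\mu$ and $\mathbb E_{\mathbb P}(\tilde{\boldsymbol\xi}\tilde{\boldsymbol\xi}^\intercal)=\boldsymbol\Sigma+\boldsymbol\mu\boldsymbol\mu^\intercal$. *)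

(* Defs.v *)
From HB Require Import structures.
From mathcomp Require Import all_boot all_order all_algebra.
From mathcomp Require Import all_classical all_reals all_analysis.

Set Implicit Arguments.
Unset Strict Implicit.
Unset Printing Implicit Defensive.

Import Order.TTheory GRing.Theory Num.Theory.
Local Open Scope classical_set_scope.
Local Open Scope ring_scope.

Definition mean_vec (R : realType) (T : nat) (mu : R) : 'cV[R]_T :=
  mu *: const_mx 1.

Definition cov_mx (R : realType) (T : nat) (sigma rho : R) : 'M[R]_T :=
  ((1 - rho) * sigma ^+ 2)%:M
  + (rho * sigma ^+ 2) *: (const_mx 1 *m (const_mx 1 : 'cV[R]_T)^T).

(* R^T is the type T.-tuple R, whose sigma-algebra is generated by the
   coordinate projections; this is the Borel sigma-algebra of R^T. *)

Definition nonneg_orthant (R : realType) (T : nat) : set (T.-tuple R) :=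
  [set x | forall t, 0 <= tnth x t].

(* The moments are integrals in \bar R. The coordinates are P-almost surely
   nonnegative, so an integral with a finite value means that the integrand
   is integrable. *)
Definition ambiguity_set (R : realType) (T : nat) (mu sigma rho : R) :
    set (probability (T.-tuple R) R) :=
  [set P : probability (T.-tuple R) R | [/\ P (@nonneg_orthant R T) = 1%E,
      forall t : 'I_T, 'E_P[fun x => tnth x t]%E = (mean_vec T mu t 0)%:E &
      forall s t : 'I_T, 'E_P[fun x => (tnth x s * tnth x t)%R]%E =
        ((cov_mx T sigma rho + mean_vec T mu *m (mean_vec T mu)^T) s t)%:E]].

Definition worst_case_prob (R : realType) (T : nat) (mu sigma rho gamma : R) :
    \bar R :=
  ereal_sup [set (P : probability (T.-tuple R) R)
                   [set x : T.-tuple R | gamma <= \prod_(t < T) tnth x t]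
            | P in @ambiguity_set R T mu sigma rho].

(* Main.v *)
(* The covariance is rho sigma^2 1 1^T + (1 - rho) sigma^2 sum_t e_t e_t^T,
   with nonnegative weights. Hence it is produced by shocks to the point mu 1
   along 1 and along each e_t, and each shock can be made rare but large
   (a displacement between - mu and M) without changing its mean or variance.
   As M grows the mass at mu 1, where the product equals mu^T, tends to 1. *)

Require Import Defs.
From mathcomp Require Import all_boot all_order all_algebra.
From mathcomp Require Import ring lra.
From mathcomp Require Import all_classical all_reals all_analysis.
From mathcomp Require Import measurable_realfun.
Import Order.TTheory GRing.Theory Num.Theory.
Local Open Scope ring_scope.

(** The witness is a sum of scaled Dirac measures; events and moments of the shock distribution
    below thus become finite sums. *)
Lemma finitely_supported_probability d (T : measurableType d) (R : realType)
  (s : seq ({nonneg R} * T)) :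
  \sum_(p <- s) p.1%:num = 1 ->
  exists P : probability T R,
    (forall A, P A = (\sum_(p <- s) p.1%:num * \1_A p.2)%:E) /\
    (forall f : T -> R, measurable_fun setT f ->
       'E_P[f]%E = (\sum_(p <- s) p.1%:num * f p.2)%:E).
Proof.
case: s => [|p0 s0]; first by rewrite big_nil => /eqP; rewrite eq_sym oner_eq0.
set s := p0 :: s0; move: s => s sum1.
pose m (k : nat) : {measure set T -> \bar R} :=
  mscale (nth p0 s k).1 (dirac (nth p0 s k).2).
pose mu : {measure set T -> \bar R} := msum m (size s).
have muE A : mu A = (\sum_(p <- s) p.1%:num * \1_A p.2)%:E.
  by rewrite (big_nth p0) big_mkord -sumEFin.
have mu1 : mu setT = 1%E.
  by rewrite muE -sum1; congr EFin; apply: eq_bigr => p _; rewrite indicT mulr1.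
(* The mass of [mu] is already 1, so normalizing keeps its values and supplies the [probability]
   structure. *)
pose P : probability T R := mnormalize mu (dirac p0.2).
have PE A : P A = mu A.
  by rewrite /P /= /mnormalize mu1 /= onee_eq0 /= invr1 mule1.
exists P; split=> [A|f mf]; first by rewrite PE.
(* Integrals split over sums and multiples of measures for nonnegative integrands; a general [f] is
   then handled through its positive and negative parts. *)
have ge0E (g : T -> R) : measurable_fun setT g -> (forall x, 0 <= g x) ->
    (\int[P]_x (g x)%:E)%E = (\sum_(p <- s) p.1%:num * g p.2)%:E.
  move=> mg g0.
  have mgE : measurable_fun setT (EFin \o g) by exact/measurable_EFinP.
  rewrite (big_nth p0) big_mkord -sumEFin.
  rewrite (eq_measure_integral mu); last by move=> A _ _; exact: PE.
  rewrite ge0_integral_measure_sum//; last by move=> x _; rewrite lee_fin.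
  apply: eq_bigr => i _.
  rewrite ge0_integral_mscale//; last by move=> x _; rewrite lee_fin.
  by rewrite integral_dirac// diracT mul1e.
rewrite unlock integralE.
transitivity (\int[P]_x (f^\+%R x)%:E - \int[P]_x (f^\-%R x)%:E)%E.
  by rewrite -[X in integral _ _ X^\+%E]/(EFin \o f)
    -[X in integral _ _ X^\-%E]/(EFin \o f) funerpos funerneg.
rewrite !ge0E//; [|exact: measurable_funrneg|exact: measurable_funrpos].
rewrite -EFinB -sumrB; congr EFin; apply: eq_bigr => p _.
by rewrite -mulrBr; congr (_ * _); rewrite -[in RHS](funrposBneg f).
Qed.

(* The j-th shock moves the centre mu 1 by M v_j with probability up j and by
   - mu v_j with probability dn j; this displacement has mean zero and second
   moment a_j v_j v_j^T, while up j + dn j = a_j / (mu M) is small for large M.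
   The bound v <= 1 keeps the downward move in the orthant. *)
Lemma rare_shocks (R : realType) (T : nat) (J : finType) (mu e : R)
  (a : J -> R) (v : J -> 'I_T -> R) :
  0 < mu -> 0 < e <= 1 -> (forall j, 0 <= a j) ->
  (forall j t, 0 <= v j t <= 1) ->
  exists P : probability (T.-tuple R) R,
    [/\ P (@nonneg_orthant R T) = 1%E,
        forall t, 'E_P[fun x => tnth x t]%E = mu%:E,
        forall s t, 'E_P[fun x => (tnth x s * tnth x t)%R]%E =
          (mu ^+ 2 + \sum_j a j * v j s * v j t)%:E &
        forall A : set (T.-tuple R), A [tuple mu | _ < T] ->
          ((1 - e)%:E <= P A)%E].
Proof.
move=> mu0 /andP[e0 e1] a0 v01.
pose A := \sum_j a j.
have A0 : 0 <= A by exact: sumr_ge0.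
(* Chosen so that the total shock probability is A / (mu M) = e A / (A + 1) <= e; the + 1 keeps [M]
   positive even if A = 0. *)
pose M := (A + 1) / (mu * e).
have M0 : 0 < M by rewrite divr_gt0 ?mulr_gt0 //; lra.
(* The weights solve up M = dn mu (zero mean) and up M^2 + dn mu^2 = a (second moment). *)
pose up j := a j / (M * (M + mu)).
pose dn j := a j / (mu * (M + mu)).
have up0 j : 0 <= up j by rewrite divr_ge0// mulr_ge0; lra.
have dn0 j : 0 <= dn j by rewrite divr_ge0// mulr_ge0; lra.
pose q := \sum_j (up j + dn j).
have qE : q = A / (mu * M).
  rewrite /q /A mulr_suml; apply: eq_bigr => j _; rewrite /up /dn.
  by field; rewrite !gt_eqF //; lra.
have qe : q <= e.
  have -> : q = e * (A / (A + 1)).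
    by rewrite qE /M; field; rewrite !gt_eqF //; lra.
  by rewrite ler_piMr ?(ltW e0)// ler_pdivrMr; lra.
have c0 : 0 <= 1 - q by lra.
pose x0 := [tuple mu | _ < T].
pose xu j := [tuple mu + M * v j t | t < T].
pose xd j := [tuple mu - mu * v j t | t < T].
pose s : seq ({nonneg R} * T.-tuple R) :=
  (NngNum c0, x0) ::
  [seq (NngNum (up0 j), xu j) | j <- index_enum J] ++
  [seq (NngNum (dn0 j), xd j) | j <- index_enum J].
(* Writing expectations as the value at the centre plus increments lets each moment be checked one
   shock at a time. *)
have sE (f : T.-tuple R -> R) : \sum_(p <- s) p.1%:num * f p.2 =
    f x0 + \sum_j (up j * (f (xu j) - f x0) + dn j * (f (xd j) - f x0)).
  rewrite big_cons big_cat !big_map /= mulrBl mul1r -addrA; congr (_ + _).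
  rewrite -big_split /= /q mulr_suml -sumrN -big_split /=.
  by apply: eq_bigr => j _; ring.
have s1 : \sum_(p <- s) p.1%:num = 1.
  under eq_bigr => p _ do rewrite -[p.1%:num]mulr1.
  rewrite (sE (fun=> 1)) big1 ?addr0// => j _; ring.
have [P [PE EE]] := finitely_supported_probability _ _ _ _ s1.
have mt t : measurable_fun setT (fun x : T.-tuple R => tnth x t).
  exact: measurable_tnth.
exists P; split.
- rewrite PE sE /=.
  have in1 (x : T.-tuple R) : (forall t, 0 <= tnth x t) ->
      \1_(@nonneg_orthant R T) x = 1 :> R.
    by move=> hx; rewrite indicE mem_set.
  rewrite in1; last by move=> t; rewrite tnth_mktuple ltW.
  rewrite big1 ?addr0// => j _.
  rewrite !in1 ?subrr ?mulr0 ?addr0// => t; rewrite tnth_mktuple;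
    have /andP[? ?] := v01 j t; nra.
- move=> t; rewrite EE// (sE (fun x => tnth x t)) tnth_mktuple.
  rewrite big1 ?addr0// => j _.
  rewrite !tnth_mktuple /up /dn.
  by field; rewrite !gt_eqF //; lra.
- move=> i t; rewrite EE; last by apply: measurable_funM; exact: mt.
  rewrite (sE (fun x => tnth x i * tnth x t)) !tnth_mktuple expr2.
  congr (_ + _)%:E; apply: eq_bigr => j _.
  rewrite !tnth_mktuple /up /dn.
  by field; rewrite !gt_eqF //; lra.
(* The atom at the centre alone weighs 1 - q >= 1 - e. *)
- move=> B Bx0; rewrite PE lee_fin big_cons /= indicE mem_set// mulr1.
  rewrite -[leLHS]addr0 lerD//; first by lra.
  by apply: sumr_ge0 => p _; rewrite mulr_ge0.
Qed.

Theorem proposition4p1 (R : realType) (T : nat) (mu sigma rho : R)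
  (hT : (2 <= T)%N) (hmu : 0 < mu) (hsigma : 0 < sigma)
  (hrho_lb : - (1 / (T%:R - 1)) < rho) (hrho_ub : rho < 1)
  (hpos : 0 < mu ^+ 2 + rho * sigma ^+ 2)
  (hrho : 0 <= rho) :
  forall gamma : R, gamma <= mu ^+ T ->
    worst_case_prob T mu sigma rho gamma = 1%E.
Proof.
move=> gamma hgamma; apply/eqP; rewrite eq_le; apply/andP; split.
  apply: ge_ereal_sup => _ [P _ <-]; apply: probability_le1.
  have mprod : measurable_fun setT
      (fun x : T.-tuple R => \prod_(t < T) tnth x t).
    by apply: measurable_prod => t _; exact: measurable_tnth.
  rewrite -[X in measurable X]setTI.
  have -> : [set x : T.-tuple R | gamma <= \prod_(t < T) tnth x t]%classic =
      ((fun x : T.-tuple R => \prod_(t < T) tnth x t)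
        @^-1` `[gamma, +oo[)%classic.
    by apply/seteqP; split => x /=; rewrite in_itv /= andbT.
  by apply: mprod => //; exact: measurable_itv.
apply/lee_subgt0Pr => e e0.
(* The cap at 1 keeps the mass left at the centre nonnegative. *)
pose e' := Num.min e 1.
have e'0 : 0 < e' <= 1 by rewrite lt_min e0 ltr01 ge_min lexx orbT.
(* [inl] indexes the common shock along 1, [inr k] the shock along e_k; rho >= 0 makes the common
   weight nonnegative. *)
pose a (j : 'I_1 + 'I_T) :=
  if j is inl _ then rho * sigma ^+ 2 else (1 - rho) * sigma ^+ 2.
pose v (j : 'I_1 + 'I_T) (t : 'I_T) : R :=
  if j is inr k then (k == t)%:R else 1.
have a0 j : 0 <= a j by case: j => j /=; rewrite mulr_ge0 ?sqr_ge0//; lra.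
have v01 j t : 0 <= v j t <= 1.
  by case: j => k /=; rewrite ?ler01 ?lexx//; case: eqP; rewrite ler01 lexx.
have [P [Psupp Pmean Pcov Pcentre]] := rare_shocks _ _ _ _ _ _ _ hmu e'0 a0 v01.
have PP : @ambiguity_set R T mu sigma rho P.
  split=> // [t|s t]; first by rewrite Pmean !mxE mulr1.
  rewrite Pcov; congr EFin.
  (* Among the coordinate shocks only k = s can contribute to entry (s, t), and it does so exactly
     when s = t. *)
  rewrite big_sumType /= big_ord1 (bigD1 s)//= big1; last first.
    by move=> k /negPf ks; rewrite ks mulr0 mul0r.
  rewrite !mxE !big_ord1 !mxE eqxx mulr1n.
  by case: (s == t) => /=; rewrite ?mulr1n ?mulr0n; ring.
apply: (@le_trans _ _ (1 - e')%:E).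
  by rewrite -EFinB lee_fin lerB// ge_min lexx.
apply: (@le_trans _ _
  (P [set x : T.-tuple R | gamma <= \prod_(t < T) tnth x t]%classic)).
  apply: Pcentre => /=; under eq_bigr => t _ do rewrite tnth_mktuple.
  by rewrite prodr_const card_ord.
by apply: ereal_sup_ubound; exists P.
Qed.
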